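(* For every integer $k \geq 2$, $g(2,k) = k-1$.
   Context: All graphs are finite and simple. For a graph $G$ and an integer $k \geq 2$, $f_k(G)$ denotes the minimum number of vertices that must be deleted from $G$ to obtain an induced subgraph $H$ in which at least $k$ vertices have degree $\Delta(H)$ (the maximum degree of $H$), or otherwise $|H| < k$, where $|H|$ is the number of vertices of $H$. For integers $\Delta \geq 0$ and $k \geq 2$, $g(\Delta,k) = \max\{ f_k(G) : \Delta(G) \leq \Delta\}$, the maximum being over all graphs $G$ with maximum degree at most $\Delta$. *)

(* Defs.v *)
From mathcomp Require Import all_boot.

Set Implicit Arguments.
Unset Strict Implicit.
Unset Printing Implicit Defensive.

Record sgraph := SGraph {
  vertex :> finType;
  adj : rel vertex;
  adj_sym : symmetric adj;
  adj_irrefl : irreflexive adj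
}.

Definition deg (G : sgraph) (x : G) : nat := #|[set y | adj x y]|.

(* An empty \max is 0, so the graph with no vertex has maximum degree 0. *)
Definition maxdeg (G : sgraph) : nat := \max_(x : G) deg x.

Definition induced_adj (G : sgraph) (A : {set G}) : rel {x : G | x \in A} :=
  fun x y => adj (val x) (val y).

Lemma induced_adj_sym (G : sgraph) (A : {set G}) : symmetric (induced_adj (A:=A)).
Proof. by move=> x y; apply: adj_sym. Qed.

Lemma induced_adj_irrefl (G : sgraph) (A : {set G}) :
  irreflexive (induced_adj (A:=A)).
Proof. by move=> x; apply: adj_irrefl. Qed.

Definition induced (G : sgraph) (A : {set G}) : sgraph :=
  SGraph (induced_adj_sym (A:=A)) (induced_adj_irrefl (A:=A)).

Definition del_vertices (G : sgraph) (S : {set G}) : sgraph := induced (~: S).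

Definition target (k : nat) (H : sgraph) : bool :=
  (k <= #|[set x : H | deg x == maxdeg H]|) || (#|H| < k).

(* The library's [arg min] falls back on its seed, here setT, only if the seed
   fails the condition; target_del_setT shows that this never happens. *)
Definition f (k : nat) (G : sgraph) : nat :=
  #|[arg min_(S < [set: G] | target k (del_vertices S)) #|S| ]|.

Lemma target_del_setT (k : nat) (G : sgraph) :
  target k (del_vertices [set: G]).
Proof.
rewrite /target; case: k => [|k]; first by rewrite leq0n.
apply/orP; right; rewrite eq_card0 // => -[x xA].
by exfalso; have := xA; rewrite !inE.
Qed.

(* The maximum ranges over all finite graphs, an infinite family, so
   "m = g(Delta, k)" is a relation: m is attained and is an upper bound. *)
Definition is_max (P : nat -> Prop) (m : nat) : Prop :=
  P m /\ forall n, P n -> n <= m.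

Definition is_g (Delta k m : nat) : Prop :=
  is_max (fun n => exists G : sgraph, maxdeg G <= Delta /\ f k G = n) m.

(* Main.v *)
Require Import Defs.
From mathcomp Require Import all_boot.
From mathcomp Require Import zify.

Set Implicit Arguments.
Unset Strict Implicit.
Unset Printing Implicit Defensive.

(** Lower bound. In the disjoint union of k - 1 cherries (paths on three
    vertices) only the k - 1 centres have degree 2. Deleting fewer than k - 1
    vertices leaves some cherry intact, so the maximum degree is still 2, is
    reached at most k - 1 times, and at least k vertices remain.

    Upper bound. Let G have maximum degree at most 2 and fewer than k vertices
    of degree 2. As long as two vertices of degree 2 are adjacent, delete one
    of them: each deletion destroys at least two vertices of degree 2
    ([thin_of_deg]). After t deletions what remains is a disjoint union of a
    cherries, b isolated edges and some isolated vertices, and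
    2t + a <= k - 1. There are two ways to continue.
    - Delete one leaf of each cherry ([trim_cherries]). This costs t + a
      <= k - 1 deletions and leaves a graph of maximum degree at most 1 with
      2(a + b) vertices of degree 1, which succeeds when 2(a + b) >= k.
    - Delete the centre of each cherry and one end of each isolated edge
      ([half_cover]). This costs t + a + b deletions and leaves no edge, which
      always succeeds. When 2(a + b) <= k - 1, adding this inequality to
      2t + a <= k - 1 gives 2(t + a + b) <= 2(k - 1).

    The formal argument never decomposes a graph into components: it counts
    the vertices of degree 1 and 2, so that b appears only through the number
    2b of vertices of degree 1 once the centres are removed. *)

(** * Degrees in induced subgraphs *)

Section InducedDegrees.
Variable G : sgraph.
Implicit Types (A B S : {set G}) (x y : G).

(** Subgraphs are represented by their vertex sets in a fixed ambient graph, so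
    that successive deletions do not build nested subtypes; [target_induced]
    translates back to the induced graphs themselves. *)
Definition nbrs A x : {set G} := [set y in A | adj x y].
Definition deg_in A x : nat := #|nbrs A x|.
Definition of_deg d A : {set G} := [set x in A | deg_in A x == d].
Definition deg_le d A : Prop := forall x, x \in A -> deg_in A x <= d.

Lemma deg_inS A B x : A \subset B -> deg_in A x <= deg_in B x.
Proof.
move=> /subsetP sAB; apply/subset_leq_card/subsetP => y.
by rewrite !inE => /andP[/sAB-> ->].
Qed.

Lemma deg_leS d A B : A \subset B -> deg_le d B -> deg_le d A.
Proof.
by move=> sAB leB x xA; rewrite (leq_trans (deg_inS x sAB)) ?leB ?(subsetP sAB).
Qed.

Lemma deg_in_gt0 A x y : y \in A -> adj x y -> 0 < deg_in A x.
Proof. by move=> yA xy; apply/card_gt0P; exists y; rewrite inE yA. Qed.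

Lemma deg_in_remove A B x y :
  A \subset B -> y \in B -> y \notin A -> adj x y -> deg_in A x < deg_in B x.
Proof.
move=> /subsetP sAB yB yA xy; apply/proper_card/properP; split.
  by apply/subsetP => z; rewrite !inE => /andP[/sAB-> ->].
by exists y; rewrite !inE ?yB // (negPf yA).
Qed.

Lemma nbr_unique A x y z :
  deg_in A x <= 1 -> y \in A -> z \in A -> adj x y -> adj x z -> y = z.
Proof.
by move=> /card_le1_eqP le1 yA zA xy xz; apply: le1; rewrite inE ?yA ?zA.
Qed.

Lemma deg_induced A (x : induced A) : deg x = deg_in A (val x).
Proof.
rewrite /deg /deg_in -(card_imset _ val_inj).
apply: eq_card => y; rewrite inE.
apply/imsetP/andP => [[z]|[yA xy]].
  by rewrite inE => xz ->; split=> //; apply: (valP z).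
by exists (Sub y yA) => //; rewrite inE.
Qed.

Lemma card_induced A : #|induced A| = #|A|.
Proof. exact: card_sig. Qed.

Lemma maxdeg_le d A : deg_le d A -> maxdeg (induced A) <= d.
Proof.
by move=> leA; apply/bigmax_leqP => x _; rewrite deg_induced leA ?(valP x).
Qed.

Lemma target_induced k d A x : deg_le d A -> x \in of_deg d A ->
  target k (induced A) = (k <= #|of_deg d A|) || (#|A| < k).
Proof.
move=> leA; rewrite inE => /andP[xA /eqP xd].
have maxE : maxdeg (induced A) = d.
  apply/eqP; rewrite eqn_leq maxdeg_le //= -xd.
  by rewrite -(deg_induced (A := A) (Sub x xA)); apply: leq_bigmax.
rewrite /target card_induced maxE; congr ((_ <= _) || _).
rewrite -(card_imset _ val_inj); apply: eq_card => y; rewrite inE.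
apply/imsetP/andP => [[z]|[yA yd]].
  by rewrite inE deg_induced => zd ->; split=> //; apply: (valP z).
by exists (Sub y yA) => //; rewrite inE deg_induced.
Qed.

Lemma target_many k d A : 0 < k -> deg_le d A -> k <= #|of_deg d A| ->
  target k (induced A).
Proof.
move=> k_gt0 leA le_k.
have /card_gt0P[x xd] := leq_trans k_gt0 le_k.
by rewrite (target_induced k leA xd) le_k.
Qed.

(** All degrees are then 0, so every remaining vertex counts: either there are
    k of them or fewer than k are left. *)
Lemma target_edgeless k A : 0 < k -> deg_le 0 A -> target k (induced A).
Proof.
move=> k_gt0 le0; have [ltk|lek] := ltnP #|A| k.
  by rewrite /target card_induced ltk orbT.
apply: (target_many k_gt0 le0); rewrite (leq_trans lek) //.
by apply/subset_leq_card/subsetP => x xA; rewrite inE xA -leqn0 le0.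
Qed.

Lemma f_le k S : target k (del_vertices S) -> f k G <= #|S|.
Proof.
rewrite /f => tS; case: arg_minnP => [|S0 _ minS]; first exact: target_del_setT.
exact: minS.
Qed.

Lemma f_ge k m :
  (forall S, target k (del_vertices S) -> m <= #|S|) -> m <= f k G.
Proof.
rewrite /f => tm; case: arg_minnP => [|S0 tS _]; first exact: target_del_setT.
exact: tm.
Qed.

Lemma f_le_keep k A : target k (induced A) -> f k G <= #|~: A|.
Proof. by move=> tA; apply: f_le; rewrite /del_vertices setCK. Qed.

(** * The upper bound *)

(** Of two adjacent vertices whose degree is the bound d, delete one: it
    disappears, its neighbour drops below d, and no vertex can rise to d. So
    every deletion removes at least two vertices of degree d, which is what the
    inequality records, written without subtraction. It is used with d = 2 to
    reach a disjoint union of cherries and smaller components, and with d = 1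
    to halve a matching. *)
Lemma thin_of_deg d A : deg_le d A ->
  exists B, [/\ B \subset A,
    2 * #|A| + #|of_deg d B| <= #|of_deg d A| + 2 * #|B| &
    {in of_deg d B &, forall x y, ~~ adj x y}].
Proof.
have [n] := ubnP #|A|; elim: n A => // n IHn A leAn leA.
have [indep|] := boolP [forall x in of_deg d A, forall y in of_deg d A, ~~ adj x y].
  exists A; split=> //; first by rewrite addnC.
  by move=> x y xd yd; exact: (forall_inP (forall_inP indep x xd) y yd).
rewrite negb_forall_in => /exists_inP[x xd].
rewrite negb_forall_in => /exists_inP[y yd /negPn xy].
have [xA yA] : x \in A /\ y \in A by move: xd yd; rewrite !inE => /andP[-> _] /andP[-> _].
have sA : A :\ x \subset A by rewrite subD1set.
have cA := cardsD1 x A; rewrite xA in cA.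
have [||B [sB cB indep]] := IHn (A :\ x); first by lia.
  exact: deg_leS leA.
exists B; split=> //; first exact: subset_trans sB sA.
have xNy : y != x by apply: contraTneq xy => ->; rewrite adj_irrefl.
(* A vertex of degree d in A :\ x already has degree d in A, as d is the bound. *)
have : of_deg d (A :\ x) \subset of_deg d A :\ x :\ y.
  apply/subsetP => z; rewrite !inE => /andP[/andP[zNx zA] /eqP zd].
  rewrite zNx zA /= andbC eqn_leq leA //= -{1}zd deg_inS //=.
  apply: contraTneq xy => zy; rewrite adj_sym; apply/negP => yx.
  have := deg_in_remove sA xA _ yx; rewrite !inE eqxx => /(_ isT).
  by move: yd; rewrite inE -zy zd => /andP[_ /eqP->]; rewrite ltnn.
move=> /subset_leq_card.
have := cardsD1 x (of_deg d A); have := cardsD1 y (of_deg d A :\ x).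
by rewrite xd 2!inE xNy yd /=; lia.
Qed.

(** When degrees are at most 1, both ends of an edge have degree exactly 1, so a
    set without adjacent vertices of degree 1 has no edge left. *)
Lemma half_cover A : deg_le 1 A ->
  exists B, [/\ B \subset A, deg_le 0 B & 2 * #|A| <= #|of_deg 1 A| + 2 * #|B|].
Proof.
move=> leA; have [B [sB cB indep]] := thin_of_deg leA.
exists B; split=> //; last by lia.
have deg1 z t : z \in B -> t \in B -> adj z t -> z \in of_deg 1 B.
  move=> zB tB zt; rewrite inE zB eqn_leq (deg_leS sB leA) //=.
  exact: deg_in_gt0 tB zt.
move=> x xB; rewrite leqNgt; apply/negP => /card_gt0P[y].
rewrite inE => /andP[yB xy].
have yx : adj y x by rewrite adj_sym.
by have := indep x y (deg1 x y xB yB xy) (deg1 y x yB xB yx); rewrite xy.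
Qed.

(** Here T is the set of centres of the cherries. Removing one leaf of each
    cherry keeps its centre and its other leaf as the two ends of an edge, and
    does not touch the isolated edges, whose ends are the vertices of degree 1
    of B :\: T. These three families of vertices of degree 1 are disjoint. *)
Lemma trim_cherries B : deg_le 2 B ->
  {in of_deg 2 B &, forall x y, ~~ adj x y} ->
  let T := of_deg 2 B in
  exists A, [/\ #|B| <= #|A| + #|T|, deg_le 1 A &
    2 * #|T| + #|of_deg 1 (B :\: T)| <= #|of_deg 1 A|].
Proof.
move=> leB indep T.
have le1 x : x \in B -> x \notin T -> deg_in B x <= 1.
  by move=> xB; rewrite inE xB /= => /negPf xd; have := leB x xB; rewrite leq_eqVlt xd.
have TB x : x \in T -> x \in B by rewrite inE => /andP[].
have adjNT x y : x \in T -> adj x y -> y \notin T.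
  by move=> xT; apply: contraTN => yT; apply: indep.
(* For a centre x, p x is the pair (deleted leaf, surviving leaf). *)
have : forall x, exists p : G * G, x \in T ->
    [/\ p.1 \in B, p.2 \in B, adj x p.1, adj x p.2 & p.1 != p.2].
  move=> x; have [xT|] := boolP (x \in T); last by exists (x, x).
  move: (xT); rewrite inE => /andP[_ /cards2P[y [z [yz E]]]].
  exists (y, z) => _ /=.
  have := set21 y z; have := set22 y z; rewrite -E !inE.
  by move=> /andP[-> ->] /andP[-> ->].
move=> /fin_all_exists[p pP].
pose D := [set (p x).1 | x in T]; pose A := B :\: D.
have sAB : A \subset B by apply: subsetDl.
(* A neighbour of a centre is a leaf and has no other neighbour; this is what
   keeps distinct cherries, and cherries and isolated edges, apart. *)
have alone x y t : x \in B -> y \in B -> t \in T -> adj t x -> adj x y -> y = t.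
  move=> xB yB tT tx xy; apply: (nbr_unique (le1 x xB (adjNT t x tT tx))) => //.
    exact: TB.
  by rewrite adj_sym.
have TA x : x \in T -> x \in A.
  move=> xT; rewrite inE TB // andbT; apply/imsetP => -[t tT xE].
  by have [_ _ tx _ _] := pP t tT; have := adjNT t _ tT tx; rewrite -xE xT.
have gA x : x \in T -> (p x).2 \in A.
  move=> xT; have [_ gB _ xg neq] := pP x xT; rewrite inE gB andbT.
  apply/imsetP => -[t tT gE]; have [_ _ tg _ _] := pP t tT.
  have xt : x = t by apply: (alone (p x).2) => //; rewrite ?TB ?gE // -gE adj_sym.
  by move: neq; rewrite gE -xt eqxx.
have leA : deg_le 1 A.
  move=> x xA; have xB := subsetP sAB x xA.
  have [xT|xNT] := boolP (x \in T); last exact: leq_trans (deg_inS x sAB) (le1 x xB xNT).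
  have [hB _ xh _ _] := pP x xT.
  rewrite -ltnS; apply: leq_trans (leB x xB).
  by apply: deg_in_remove xh => //; rewrite inE hB andbT negbK; apply/imsetP; exists x.
have deg1 x y : x \in A -> y \in A -> adj x y -> x \in of_deg 1 A.
  by move=> xA yA xy; rewrite inE xA eqn_leq leA //=; apply: deg_in_gt0 yA xy.
have edgeP x : x \in of_deg 1 (B :\: T) ->
    [/\ x \in B, x \notin T & exists y, [/\ y \in B, y \notin T & adj x y]].
  rewrite inE => /andP[]; rewrite inE => /andP[xNT xB] /eqP x1; split=> //.
  have /card_gt0P[y] : 0 < deg_in (B :\: T) x by rewrite x1.
  by rewrite inE in_setD -andbA => /and3P[yNT yB xy]; exists y.
have farA x y : x \in B -> y \in B -> y \notin T -> adj x y -> x \in A.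
  move=> xB yB yNT xy; rewrite inE xB andbT; apply/imsetP => -[t tT xE].
  have [_ _ tx _ _] := pP t tT; rewrite -xE in tx.
  by move: yNT; rewrite (alone x y t) ?tT.
exists A; split=> //.
  have cD : #|D| <= #|T| by apply: leq_imset_card.
  by have := cardsID D B; have := subset_leq_card (subsetIr B D); rewrite -/A; lia.
pose E := [set (p x).2 | x in T].
have cE : #|E| = #|T|.
  apply: card_in_imset => x t xT tT gE.
  have [_ gB _ xg _] := pP x xT; have [_ _ _ tg _] := pP t tT.
  apply: (alone (p x).2) => //; first exact: TB.
    by rewrite gE.
  by rewrite adj_sym.
have TE : [disjoint T & E].
  rewrite disjoint_sym; apply/pred0P => x; apply/andP => -[/imsetP[t tT xE] xT].
  have [_ _ _ tx _] := pP t tT; rewrite -xE in tx.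
  exact: negP (adjNT t x tT tx) xT.
have TEV : [disjoint T :|: E & of_deg 1 (B :\: T)].
  apply/pred0P => x; apply/andP => -[] /[swap] /edgeP[xB xNT [y [yB yNT xy]]].
  move=> /setUP[xT|/imsetP[t tT xE]]; first by rewrite xT in xNT.
  have [_ _ _ tx _] := pP t tT; rewrite -xE in tx.
  by move: yNT; rewrite (alone x y t) ?tT.
have cTE := leq_card_setU T E; rewrite TE in cTE.
have cTEV := leq_card_setU (T :|: E) (of_deg 1 (B :\: T)); rewrite TEV in cTEV.
have -> : 2 * #|T| + #|of_deg 1 (B :\: T)| = #|T :|: E :|: of_deg 1 (B :\: T)|.
  by move: cTE cTEV => [_ /eqP->] [_ /eqP->]; lia.
apply/subset_leq_card; rewrite !subUset -andbA; apply/and3P; split; apply/subsetP=> x.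
- move=> xT; have [_ _ _ xg _] := pP x xT.
  exact: deg1 (TA x xT) (gA x xT) xg.
- move=> /imsetP[t tT ->]; have [_ _ _ tg _] := pP t tT.
  by apply: deg1 (gA t tT) (TA t tT) _; rewrite adj_sym.
move=> /edgeP[xB xNT [y [yB yNT xy]]]; apply: (deg1 _ y) => //.
  exact: farA xy.
by apply: (farA y x); rewrite // adj_sym.
Qed.

(** The sum of the two inequalities 2t + a <= k - 1 and 2(a + b) <= k - 1 is
    taken by the last arithmetic step, with t the number of vertices outside B
    and a that of T. *)
Lemma f_le_pred k : 0 < k -> maxdeg G <= 2 -> f k G <= k - 1.
Proof.
move=> k_gt0 leG.
have leT : deg_le 2 [set: G].
  move=> x _; apply: leq_trans leG; apply: leq_trans (leq_bigmax x).
  by apply/subset_leq_card/subsetP => y; rewrite !inE.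
have cT := cardsT G.
have [many|few] := leqP k #|of_deg 2 [set: G]|.
  by apply: leq_trans (f_le_keep (target_many k_gt0 leT many)) _; rewrite setCT cards0.
have [B [sB cB indep]] := thin_of_deg leT.
have leB := deg_leS sB leT; have cBT := subset_leq_card sB.
pose T := of_deg 2 B.
have [A [cA leA cA1]] := trim_cherries leB indep; rewrite -/T in cB cA cA1.
have [manyA|fewA] := leqP k #|of_deg 1 A|.
  apply: leq_trans (f_le_keep (target_many k_gt0 leA manyA)) _.
  by have := cardsC A; lia.
have leBT : deg_le 1 (B :\: T).
  move=> x; rewrite !inE => /andP[xNT xB]; rewrite xB /= in xNT.
  apply: leq_trans (deg_inS x (subsetDl B T)) _.
  by have := leB x xB; rewrite leq_eqVlt (negPf xNT).
have [C [_ le0 cC]] := half_cover leBT.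
apply: leq_trans (f_le_keep (target_edgeless k_gt0 le0)) _.
have := cardsID T B; have := subset_leq_card (subsetIr B T).
by have := cardsC C; lia.
Qed.

End InducedDegrees.

(** * The extremal graph *)

Section Cherries.
Variable m : nat.

(** In the i-th cherry, (i, None) is the centre and (i, Some true) and
    (i, Some false) are the leaves. *)
Definition cherry_adj : rel ('I_m * option bool) :=
  fun u v => (u.1 == v.1) && (isSome u.2 != isSome v.2).

Lemma cherry_adj_sym : symmetric cherry_adj.
Proof. by move=> u v; rewrite /cherry_adj eq_sym [isSome _ == _]eq_sym. Qed.

Lemma cherry_adj_irrefl : irreflexive cherry_adj.
Proof. by move=> u; rewrite /cherry_adj !eqxx. Qed.

Definition cherries : sgraph := SGraph cherry_adj_sym cherry_adj_irrefl.

Lemma deg_cherries_leaf (A : {set cherries}) i b : deg_in A (i, Some b) <= 1.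
Proof.
apply: (leq_trans _ (eq_leq (cards1 (i, None : option bool)))).
apply/subset_leq_card/subsetP => -[j c]; rewrite !inE => /andP[_ /andP[/= /eqP<-]].
by case: c.
Qed.

Lemma deg_cherries_le (A : {set cherries}) : deg_le 2 A.
Proof.
move=> [i [b|]] _; first exact: leq_trans (deg_cherries_leaf _ _ _) _.
pose N : {set cherries} := [set (i, Some true); (i, Some false)].
have cN : #|N| = 2 by rewrite cards2 xpair_eqE eqxx.
rewrite -cN; apply/subset_leq_card/subsetP => -[j c]; rewrite !inE => /andP[_ /andP[/= /eqP<-]].
by case: c => [[]|]; rewrite ?eqxx ?orbT.
Qed.

Lemma maxdeg_cherries : maxdeg cherries <= 2.
Proof.
apply/bigmax_leqP => x _.
apply: leq_trans (deg_cherries_le (in_setT x)).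
by apply/subset_leq_card/subsetP => y; rewrite !inE.
Qed.

(** Fewer than m deleted vertices miss some cherry entirely, and its centre c
    keeps the maximum degree at 2, a degree that only the m centres can have. *)
Lemma f_cherries_ge : m <= f m.+1 cherries.
Proof.
apply: f_ge => S; apply: contraLR; rewrite -ltnNge => ltS.
have [i iS] : exists i, forall c, (i, c) \notin S.
  have /pred0Pn[i /= iS] : ~~ [disjoint [set: 'I_m] & ~: [set u.1 | u in S]].
    apply: contraL ltS; rewrite disjoints_subset setCK -leqNgt => /subset_leq_card.
    by rewrite cardsT card_ord => /leq_trans; apply; apply: leq_imset_card.
  exists i => c; apply: contraTN iS => iS.
  by rewrite !inE negbK; apply/imsetP; exists (i, c).
pose c : cherries := (i, None).
have cd : c \in of_deg 2 (~: S).
  rewrite !inE iS eqn_leq deg_cherries_le ?inE ?iS //=.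
  pose N : {set cherries} := [set (i, Some true); (i, Some false)].
  have <- : #|N| = 2 by rewrite cards2 xpair_eqE eqxx.
  apply/subset_leq_card/subsetP => v.
  by rewrite !inE => /orP[] /eqP->; rewrite iS /=; apply/andP.
rewrite /del_vertices (target_induced _ (@deg_cherries_le _) cd) negb_or -!ltnNge.
have cG : #|cherries| = m * 3 by rewrite card_prod card_ord card_option card_bool.
apply/andP; split; last by have := cardsC S; rewrite cG; lia.
pose centres : {set cherries} := [set (j, None) | j : 'I_m].
have c_centres : #|centres| <= m by rewrite (leq_trans (leq_imset_card _ _)) ?card_ord.
rewrite ltnS; apply: leq_trans c_centres.
apply/subset_leq_card/subsetP => -[j [b|]]; rewrite inE => /andP[_ jd].
  by have := deg_cherries_leaf (~: S) j b; rewrite (eqP jd).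
by apply/imsetP; exists j.
Qed.

End Cherries.

Theorem theorem4p3 (k : nat) (hk : 2 <= k) : is_g 2 k (k - 1).
Proof.
have k_gt0 : 0 < k by apply: ltnW.
split=> [|n [G [leG <-]]]; last exact: f_le_pred.
exists (cherries (k - 1)); split; first exact: maxdeg_cherries.
apply/eqP; rewrite eqn_leq f_le_pred ?maxdeg_cherries //=.
by have := f_cherries_ge (k - 1); rewrite subn1 prednK.
Qed.
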